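(* For any non-alternating AAPTA $\mathcal{A}=\langle Q,q_0,\delta,\omega\rangle$ over $2^{AP}$ ($AP$ a finite set of atomic propositions), one can build an $\mathsf{EQCTL}_2$ formula $\Phi_\mathcal{A}$ such that for every $2^{AP}$-labelled tree $\mathcal{T}$: $\mathcal{T}\in\mathcal{L}(\mathcal{A})$ if and only if $\mathcal{T},\varepsilon\models\Phi_\mathcal{A}$. The size of $\Phi_\mathcal{A}$ is in $O\big(|Q|\cdot|\omega|+|Q|\cdot2^{|AP|}\cdot|AP|\cdot|\delta|_B\cdot|\delta|_E\cdot(|\delta|_E+|\delta|_U)\big)$.
   Context: Automata: multisets over $S$ are maps $S\to\mathbb{N}$ with pointwise order $\sqsubseteq$, truncated difference $\ominus$, support $\mathrm{supp}$ and size $|\mu|=\sum\mu(s)$. An EU-pair $\langle E;U\rangle$ over $S$ ($E$ finite multiset, $U\subseteq S$) is satisfied by $\mu$ if $E\sqsubseteq\mu$ and $\mathrm{supp}(\mu\ominus E)\subseteq U$. A marking $\nu:S'\to 2^S$ satisfies $\langle E;U\rangle$ if some choice function $\nu'(s')\in\nu(s')$ has image multiset $s\mapsto|\{s':\nu'(s')=s\}|$ satisfying it; extended to positive boolean formulas over EU-pairs ($\top$, $\bot$, $\wedge$, $\vee$). An AAPTA over $\Sigma$ is $\langle Q,q_0,\delta,\omega\rangle$ with $\delta(q,\sigma)$ a positive boolean formula over EU-pairs over $Q$ and $\omega:Q\to\mathbb{N}$; non-alternating means every $\delta(q,\sigma)$ is a disjunction of EU-pairs (or $\top$/$\bot$).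 Trees: $t\subseteq D^*$ prefix-closed ($D$ finite), $\Sigma$-labelled tree $(t,l)$, $l:t\to\Sigma$. An execution tree over $(t,l)$ is a $(D\times Q)$-tree, node $(d_1,q_1)\cdots(d_k,q_k)$ labelled $(d_1\cdots d_k,q_k)$, root $(\varepsilon,q_0)$, such that for each node $x$ labelled $(m,q)$ the marking $m\cdot d\mapsto\{q':x\cdot(d,q')\text{ is a node}\}$ satisfies $\delta(q,l(m))$; accepting if on every infinite branch the least priority seen infinitely often is even; $\mathcal{L}(\mathcal{A})$ consists of the trees with an accepting execution tree. $|\delta|_B$ is the maximum size of the formulas $\delta(q,\sigma)$, $|\delta|_E$, $|\delta|_U$ the maximum of $|E|$, $|U|$ over EU-pairs in $\delta$, $|\omega|$ the number of priorities. QCTL: $\varphi::= q\mid\neg\varphi\mid\varphi\vee\varphi\mid \mathsf{EX}\varphi\mid \mathsf{E}\varphi\mathsf{U}\varphi\mid\mathsf{A}\varphi\mathsf{U}\varphi\mid\exists p.\varphi$ (propositions $p$ may lie outside $AP$), $\forall p=\neg\exists p\neg$; tree semantics at node $n$ of $(t,l)$: $\mathsf{EX}\varphi$ iff some successor satisfies $\varphi$; $\mathsf{E}\varphi\mathsf{U}\psi$ (resp. $\mathsf{A}$) iff some (resp. every) infinite branch from $n$ reaches a $\psi$-node with $\varphi$ holding before; $\exists p.\varphi$ iff some relabelling of $p$ only makes $\varphi$ true at $n$. CTL is the quantifier-free fragment; $\mathsf{EQCTL}_2$ is the set of formulas $\exists p_1\ldots\exists p_n.\forall r_1\ldots\forall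 r_m.\psi$ with $\psi$ in CTL. Size of a formula: number of construction steps.
   Formalization: The equivalence is stated for trees in which every node has a successor (it fails on finite trees, as E U and A U see only infinite branches), and in the size bound |AP|, |δ|_E and |δ|_E+|δ|_U are replaced by their maximum with 1 (the bound fails when they vanish). *)

(* Defs.v *)
From HB Require Import structures.
From mathcomp Require Import all_boot.

Set Implicit Arguments.
Unset Strict Implicit.
Unset Printing Implicit Defensive.

Section EUPairs.
Variable S : finType.

Definition multiset := {ffun S -> nat}.

Definition msub (mu nu : multiset) : bool := [forall s, mu s <= nu s].
Definition mdiff (mu nu : multiset) : multiset := [ffun s => mu s - nu s].
Definition msupp (mu : multiset) : {set S} := [set s | mu s != 0].
Definition msize (mu : multiset) : nat := \sum_(s : S) mu s.

Record eupair := EUPair { euE : multiset; euU : {set S} }.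

Definition mset_sat (mu : multiset) (p : eupair) : bool :=
  msub (euE p) mu && (msupp (mdiff mu (euE p)) \subset euU p).

Definition image_mset (S' : finType) (f : S' -> S) : multiset :=
  [ffun s => #|[set s' | f s' == s]|].

Definition marking_sat_eu (S' : finType) (nu : S' -> {set S}) (p : eupair) :
  Prop :=
  exists nu' : S' -> S,
    (forall s', nu' s' \in nu s') /\ mset_sat (image_mset nu') p.

Inductive pbf : Type :=
| PTop
| PBot
| PEU of eupair
| PAnd of pbf & pbf
| POr of pbf & pbf.

Fixpoint marking_sat (S' : finType) (nu : S' -> {set S}) (b : pbf) : Prop :=
  match b with
  | PTop => True
  | PBot => False
  | PEU p => marking_sat_eu nu p
  | PAnd b1 b2 => marking_sat nu b1 /\ marking_sat nu b2
  | POr b1 b2 => marking_sat nu b1 \/ marking_sat nu b2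
  end.

(* EU-pairs are the atoms of the formulas, hence count for 1 *)
Fixpoint pbf_size (b : pbf) : nat :=
  match b with
  | PTop | PBot | PEU _ => 1
  | PAnd b1 b2 | POr b1 b2 => (pbf_size b1 + pbf_size b2).+1
  end.

Fixpoint pbf_max (f : eupair -> nat) (b : pbf) : nat :=
  match b with
  | PTop | PBot => 0
  | PEU p => f p
  | PAnd b1 b2 | POr b1 b2 => maxn (pbf_max f b1) (pbf_max f b2)
  end.

Fixpoint eu_disjunction (b : pbf) : Prop :=
  match b with
  | PEU _ => True
  | POr b1 b2 => eu_disjunction b1 /\ eu_disjunction b2
  | _ => False
  end.

End EUPairs.

Arguments PTop {S}.
Arguments PBot {S}.

(* The word d_1 ... d_k is the sequence [:: d_1; ...; d_k]: the successors of
   a node m are the nodes of the form [rcons m d]. *)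
Record tree (D : Type) := Tree {
  node :> pred (seq D);
  node_root : node [::];
  node_prefix : forall m d, node (rcons m d) -> node m
}.

(* [label] is total for convenience; only its values on nodes are ever used. *)
Record ltree (D Sigma : Type) := LTree {
  shape :> tree D;
  label : seq D -> Sigma
}.

(* The branch quantifiers of QCTL only see infinite branches, hence QCTL is
   meaningful on leafless trees; execution trees may have leaves. *)
Definition leafless D (t : tree D) : Prop :=
  forall m, t m -> exists d, t (rcons m d).

Definition infinite_branch D (t : tree D) (n : seq D) (b : nat -> seq D) :
  Prop :=
  [/\ b 0 = n, forall i, t (b i) & forall i, exists d, b i.+1 = rcons (b i) d].

Record aapta (Sigma : finType) := AAPTA {
  state : finType;
  init : state;
  delta : state -> Sigma -> pbf state;
  prio : state -> nat
}.

Section Automata.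
Variables (Sigma : finType) (A : aapta Sigma).

Definition non_alternating : Prop :=
  forall (q : state A) (sigma : Sigma),
    [\/ delta q sigma = PTop, delta q sigma = PBot
      | eu_disjunction (delta q sigma)].

Definition delta_B : nat :=
  \max_(q : state A) \max_(sigma : Sigma) pbf_size (delta q sigma).
Definition delta_E : nat :=
  \max_(q : state A) \max_(sigma : Sigma)
    pbf_max (fun p => msize (euE p)) (delta q sigma).
Definition delta_U : nat :=
  \max_(q : state A) \max_(sigma : Sigma)
    pbf_max (fun p => #|euU p|) (delta q sigma).
Definition num_prio : nat := size (undup [seq prio q | q : state A]).

Section Executions.
Variables (D : finType) (T : ltree D Sigma).

(* The label (m, q) of a node of an execution tree; the root is labelled with
   ([::], init A). *)
Definition exec_pos (x : seq (D * state A)) : seq D := unzip1 x.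
Definition exec_state (x : seq (D * state A)) : state A :=
  last (init A) (unzip2 x).

(* The successors of m in T are indexed by the finite type of the directions d
   such that [rcons m d] is a node of T. *)
Definition exec_marking (U : tree (D * state A)) (x : seq (D * state A)) :
  {d : D | T (rcons (exec_pos x) d)} -> {set state A} :=
  fun d => [set q | U (rcons x (val d, q))].

Definition execution_tree (U : tree (D * state A)) : Prop :=
  forall x, U x ->
    T (exec_pos x) /\
    marking_sat (exec_marking U (x := x))
                (delta (exec_state x) (label T (exec_pos x))).

Definition infinitely_often (P : nat -> Prop) : Prop :=
  forall i, exists2 j, i <= j & P j.

Definition accepting (U : tree (D * state A)) : Prop :=
  forall b, infinite_branch U [::] b ->
    let seen k := infinitely_often (fun i => prio (exec_state (b i)) = k) in
    exists k, [/\ seen k, forall k', seen k' -> k <= k' & ~~ odd k].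

Definition in_language : Prop :=
  exists U, execution_tree U /\ accepting U.

End Executions.
End Automata.

Section QCTL.
Variable V : eqType.

Inductive qctl : Type :=
| QVar of V
| QNot of qctl
| QOr of qctl & qctl
| QEX of qctl
| QEU of qctl & qctl
| QAU of qctl & qctl
| QExists of V & qctl.

Definition QForall (p : V) (phi : qctl) : qctl :=
  QNot (QExists p (QNot phi)).

Fixpoint qctl_size (phi : qctl) : nat :=
  match phi with
  | QVar _ => 1
  | QNot f | QEX f | QExists _ f => (qctl_size f).+1
  | QOr f g | QEU f g | QAU f g => (qctl_size f + qctl_size g).+1
  end.

Fixpoint is_ctl (phi : qctl) : Prop :=
  match phi with
  | QVar _ => True
  | QNot f | QEX f => is_ctl f
  | QOr f g | QEU f g | QAU f g => is_ctl f /\ is_ctl g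
  | QExists _ _ => False
  end.

Definition is_EQCTL2 (phi : qctl) : Prop :=
  exists (ps rs : seq V) (psi : qctl),
    is_ctl psi /\ phi = foldr QExists (foldr QForall psi rs) ps.

Variables (D : Type) (t : tree D).

Definition relabelling (p : V) (v v' : seq D -> pred V) : Prop :=
  forall n, t n -> forall p', p' != p -> v' n p' = v n p'.

Fixpoint qsat (v : seq D -> pred V) (n : seq D) (phi : qctl) : Prop :=
  match phi with
  | QVar p => v n p
  | QNot f => ~ qsat v n f
  | QOr f g => qsat v n f \/ qsat v n g
  | QEX f => exists d, t (rcons n d) /\ qsat v (rcons n d) f
  | QEU f g => exists b, infinite_branch t n b /\
      exists i, qsat v (b i) g /\ forall j, j < i -> qsat v (b j) f
  | QAU f g => forall b, infinite_branch t n b ->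
      exists i, qsat v (b i) g /\ forall j, j < i -> qsat v (b j) f
  | QExists p f => exists v', relabelling p v v' /\ qsat v' n f
  end.

End QCTL.

(* The propositions are those of AP together with infinitely many others. *)
Definition prop_of (AP : finType) : eqType := (AP + nat)%type.

(* A 2^AP-labelled tree makes all propositions outside AP false. *)
Definition ap_valuation (AP : finType) (D : Type) (T : ltree D {set AP}) :
  seq D -> pred (prop_of AP) :=
  fun n p => match p with inl a => a \in label T n | inr _ => false end.

Definition models (AP : finType) (D : Type) (T : ltree D {set AP})
  (n : seq D) (phi : qctl (prop_of AP)) : Prop :=
  qsat T (ap_valuation T) n phi.

(* Main.v *)
Require Import Defs.
From HB Require Import structures.
From mathcomp Require Import all_boot.
From mathcomp Require Import zify boolp.

(* As the automaton is non-alternating, an execution labels every node of the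
   tree with at most one state: the label of a node fixes the states of its
   children through the choice function witnessing an EU-pair <E; U>.  The formula
   guesses this labelling, together with marks 0, 1, ...: mark i is put on the
   child which provides the i-th element of E.  If no child carries two marks and
   no two siblings carry the same mark, then <E; U> amounts to: for each i < |E|
   some child has mark i and the i-th state of E, and every child without such a
   mark has its state in U.  This avoids counting children.

   A single universally quantified proposition r serves two purposes.  A mark is
   carried by one sibling at most iff, for every r, the siblings which carry it
   agree on r.  The parity condition fails on some branch iff for some odd k and
   some r, r holds somewhere and from each node where r holds one can reach a
   strictly deeper r-node of priority k through nodes of priority at least k. *)

Set Implicit Arguments.
Unset Strict Implicit.
Unset Printing Implicit Defensive.

(** * Multisets as lists; satisfaction of an EU-pair as a matching *)

Section MultisetLists.
Variable S : finType.

(** Fixing an order on the elements gives a meaning to the [i]-th element of [E], to which mark [i]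
    refers. *)
Definition mset_list (E : multiset S) : seq S :=
  flatten [seq nseq (E s) s | s <- enum S].

Lemma count_mset_list E s : count_mem s (mset_list E) = E s.
Proof.
rewrite count_flatten -map_comp sumnE big_map big_enum /= (bigD1 s) //=.
rewrite count_nseq /= eqxx mul1n big1 ?addn0 // => s' ne_s's.
by rewrite count_nseq /= (negbTE ne_s's).
Qed.

Lemma size_mset_list E : size (mset_list E) = msize E.
Proof.
rewrite size_flatten /shape -map_comp sumnE big_map big_enum /=.
by apply: eq_bigr => s _; rewrite size_nseq.
Qed.

Lemma count_image_mset (S' : finType) (f : S' -> S) s :
  count_mem s [seq f s' | s' <- enum S'] = image_mset f s.
Proof.
by rewrite ffunE count_map -sum1_count big_enum_cond /= -sum1dep_card.
Qed.

(** Counting becomes matching: [t1] pairs points of [S'] with the listed occurrences of [E], and the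
    images of [t2] make up the difference, which has to lie in [U]. *)
Lemma mset_satP (S' : finType) (f : S' -> S) (p : eupair S) :
  mset_sat (image_mset f) p <->
  exists t1 t2, [/\ perm_eq (t1 ++ t2) (enum S'),
    [seq f s | s <- t1] = mset_list (euE p) & {in t2, forall s, f s \in euU p}].
Proof.
split=> [/andP[/forallP le_E /subsetP sub_U] | [t1 [t2 [perm_t f_t1 f_t2]]]].
  set L := [seq f s | s <- enum S'].
  have countL s : count_mem s L = image_mset f s by exact: count_image_mset.
  (* [R] lists the surplus over [E], so that the list of [E] followed by [R] rearranges the list of
     images; the rearrangement is then lifted to [S'] through indices. *)
  pose R := flatten [seq nseq (mdiff (image_mset f) (euE p) s) s | s <- enum S].
  have perm_L : perm_eq (mset_list (euE p) ++ R) L.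
    apply/allP => s _ /=; rewrite count_cat countL.
    by rewrite !count_mset_list [mdiff _ _ s]ffunE subnKC.
  (* The empty [S'] is treated apart, as [nth] below needs a default element [s0]. *)
  case s0E: (enum S') => [|s0 e].
    exists [::], [::]; split=> //.
    move: perm_L; rewrite /L s0E /= => /perm_size/eqP.
    by rewrite size_cat addn_eq0 !size_eq0 => /andP[/eqP->].
  have /(perm_iotaP (f s0))[Is perm_Is def_t] := perm_L.
  pose t := [seq nth s0 (enum S') i | i <- Is].
  have f_t : [seq f s | s <- t] = mset_list (euE p) ++ R.
    rewrite def_t -map_comp; apply/eq_in_map => i /=.
    rewrite (perm_mem perm_Is) mem_iota /= add0n size_map => lt_i.
    by rewrite /L (nth_map s0 (f s0)).
  exists (take (size (mset_list (euE p))) t), (drop (size (mset_list (euE p))) t).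
  split.
  - rewrite cat_take_drop -s0E.
    have -> : enum S' = [seq nth s0 (enum S') i | i <- iota 0 (size (enum S'))].
      by rewrite map_nth_iota0 // take_size.
    by apply: perm_map; move: perm_Is; rewrite size_map.
  - by rewrite map_take f_t take_size_cat.
  move=> s /(map_f f); rewrite map_drop f_t drop_size_cat //.
  case/flattenP => _ /mapP[u _ ->] /[!mem_nseq]/andP[mu_u /eqP->].
  by apply: sub_U; rewrite inE -lt0n.
have countE s :
    image_mset f s = euE p s + count_mem s [seq f s' | s' <- t2].
  rewrite -count_image_mset -count_mset_list -f_t1 -count_cat -map_cat.
  by apply/esym/permP/perm_map.
apply/andP; split; first by apply/forallP => s; rewrite countE leq_addr.
apply/subsetP => s; rewrite inE ffunE countE addKn -lt0n -has_count.
by case/hasP => _ /mapP[s' t2s' ->] /eqP<-; apply: f_t2.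
Qed.

End MultisetLists.

(** * The transition condition at a node, without counting *)

Section LocalSteps.
Variables (S D : finType).

(* [mark d i] says that the child [d] witnesses the [i]-th element of [E]. *)
Fixpoint step (ch : pred D) (lab : D -> pred S) (mark : D -> pred nat)
    (b : pbf S) : Prop :=
  match b with
  | PTop => True
  | PBot | PAnd _ _ => False
  | PEU p =>
    (forall i s0, i < size (mset_list (euE p)) ->
      exists d, [/\ ch d, mark d i & lab d (nth s0 (mset_list (euE p)) i)]) /\
    (forall d, ch d ->
      (exists2 i, i < size (mset_list (euE p)) & mark d i) \/
      (exists2 s, s \in euU p & lab d s))
  | POr b1 b2 => step ch lab mark b1 \/ step ch lab mark b2
  end.

(** [step] looks only at children and at marks below the size of some [E]. Hence labellings may be
    exchanged as soon as they agree on nodes and on finitely many marks. *)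
Lemma eq_step (M : nat) (ch : pred D) (lab lab' : D -> pred S)
    (mark mark' : D -> pred nat) (b : pbf S) :
  (forall d, ch d -> lab d =1 lab' d) ->
  (forall d i, ch d -> i < M -> mark d i = mark' d i) ->
  pbf_max (fun p => msize (euE p)) b <= M ->
  step ch lab mark b -> step ch lab' mark' b.
Proof.
move=> eq_lab eq_mark; elim: b => //= [p|b1 IH1 b2 IH2]; last first.
  by rewrite geq_max => /andP[/IH1{}IH1 /IH2{}IH2] [/IH1|/IH2]; [left | right].
rewrite -size_mset_list => le_M.
case=> stepE stepU; split=> [i s0 lt_i|d chd].
  have [d [chd mark_i lab_i]] := stepE i s0 lt_i.
  by exists d; rewrite -eq_mark -?eq_lab // (leq_trans lt_i).
case: (stepU d chd) => [[i lt_i mark_i]|[s Us lab_s]]; [left | right].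
  by exists i; rewrite -?eq_mark // (leq_trans lt_i).
by exists s; rewrite -?eq_lab.
Qed.

(** Unique labels force the choice function, and sending [i] to the child with mark [i] is injective
    because marks are exclusive. The image is the part matched with [E]; as siblings never share a
    mark, any other child carries no mark below the size of [E], so its state is in [U]. *)
Lemma step_marking_sat (M : nat) (ch : pred D) (lab : D -> pred S)
    (mark : D -> pred nat) (nu : {d : D | ch d} -> {set S}) (b : pbf S) :
  (forall d s s', ch d -> lab d s -> lab d s' -> s = s') ->
  (forall d i j, ch d -> i < M -> j < M -> mark d i -> mark d j -> i = j) ->
  (forall d d' i, ch d -> ch d' -> i < M -> mark d i -> mark d' i -> d = d') ->
  (forall d s, lab (val d) s -> s \in nu d) ->
  pbf_max (fun p => msize (euE p)) b <= M ->
  step ch lab mark b -> marking_sat nu b.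
Proof.
move=> lab_inj mark_inj mark_uniq lab_nu.
elim: b => [||p|b1 _ b2 _|b1 IH1 b2 IH2] //=; last first.
  by rewrite geq_max => /andP[/IH1{}IH1 /IH2{}IH2] [/IH1|/IH2]; [left | right].
rewrite -size_mset_list; set l := mset_list _ => le_lM [stepE stepU].
(* Every child has a label: one with mark [i] is, by uniqueness among siblings, the child provided
   by [stepE], which is labelled. *)
have lab_ex (d : {d : D | ch d}) : exists s, lab (val d) s.
  case: (stepU _ (valP d)) => [[i lt_i mark_i]|[s _ lab_s]]; last by exists s.
  case: l lt_i stepE le_lM {stepU} => // s0 l' lt_i stepE le_lM.
  have [d' [chd' mark'_i lab'_i]] := stepE i s0 lt_i.
  have -> : val d = d' by apply: (mark_uniq _ _ i) (valP d) chd' _ _ _ => //;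
    exact: leq_trans le_lM.
  by eexists; exact: lab'_i.
have [nu' lab_nu'] := choice lab_ex.
exists nu'; split=> [d|]; first exact: lab_nu.
apply/mset_satP; rewrite -/l.
case l_eq: l => [|s0 l'].
  exists [::], (enum {: {d : D | ch d}}); split=> // d _.
  have [[i]|[s Us lab_s]] := stepU _ (valP d); first by rewrite l_eq.
  by rewrite (lab_inj _ _ _ (valP d) (lab_nu' d) lab_s).
rewrite -l_eq.
have /choice[g gP] (i : 'I_(size l)) : exists d : {d : D | ch d},
    mark (val d) i /\ nu' d = nth s0 l i.
  have [d [chd mark_i lab_i]] := stepE i s0 (ltn_ord i).
  exists (exist _ d chd); split=> //.
  exact: lab_inj chd (lab_nu' (exist _ d chd)) lab_i.
have ltM (i : 'I_(size l)) : i < M by exact: leq_trans (ltn_ord i) le_lM.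
pose t1 := [seq g i | i <- enum 'I_(size l)].
exists t1, [seq d <- enum {: {d : D | ch d}} | d \notin t1]; split.
- rewrite uniq_perm ?enum_uniq //.
    rewrite cat_uniq filter_uniq ?enum_uniq // map_inj_in_uniq ?enum_uniq.
      rewrite andbT; apply/hasPn => d.
      by rewrite mem_filter => /andP[].
    move=> i j _ _ eq_g; apply/val_inj.
    apply: (mark_inj (val (g i)) _ _ (valP _) (ltM i) (ltM j)).
      by case: (gP i).
    by rewrite eq_g; case: (gP j).
  by move=> d; rewrite mem_cat mem_filter !mem_enum andbT orbN.
- rewrite -map_comp -[RHS](mkseq_nth s0) /mkseq -val_enum_ord -map_comp.
  by apply: eq_map => i /=; case: (gP i).
move=> d; rewrite mem_filter => /andP[t1'd _].
case: (stepU _ (valP d)) => [[i lt_i mark_i]|[s Us lab_s]]; last first.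
  by rewrite (lab_inj _ _ _ (valP d) (lab_nu' d) lab_s).
case/negP: t1'd; apply/mapP; exists (Ordinal lt_i); rewrite ?mem_enum //.
apply/val_inj/(mark_uniq _ _ i); rewrite ?valP //.
  exact: leq_trans lt_i le_lM.
by case: (gP (Ordinal lt_i)).
Qed.

(** A true disjunction of EU-pairs has a true EU-pair, so one choice function suffices. [f] is
    partial because [PTop] leaves the children unlabelled. Marks given by a function [g] are
    exclusive, and injectivity makes them unique among siblings. *)
Lemma marking_sat_step (ch : pred D) (nu : {d : D | ch d} -> {set S})
    (b : pbf S) :
  [\/ b = PTop, b = PBot | eu_disjunction b] -> marking_sat nu b ->
  exists (f : D -> option S) (g : D -> nat),
    [/\ injective g,
        forall d s, f d = Some s -> exists chd, s \in nu (exist _ d chd)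
      & step ch (fun d s => f d == Some s) (fun d i => g d == i) b].
Proof.
case=> [-> _|-> //|].
  exists (fun=> None), (fun d => val (enum_rank d)); split=> // d d' eq_dd'.
  exact/enum_rank_inj/val_inj.
elim: b => //= [p _|b1 IH1 b2 IH2 [eu1 eu2] []]; last 2 first.
- by case/(IH1 eu1) => f [g [? ? ?]]; exists f, g; split=> //; left.
- by case/(IH2 eu2) => f [g [? ? ?]]; exists f, g; split=> //; right.
case=> nu' [nu'P /mset_satP[t1 [t2 [perm_t nu'_t1 nu'_t2]]]].
(* The matched children come first, so that their positions are the indices in the list of [E];
   directions that are not children come last, which makes the position injective on all of [D]. *)
pose t := [seq val d | d <- t1 ++ t2] ++ [seq d <- enum D | ~~ ch d].
pose f d := omap nu' (insub d).
have f_val d : f (val d) = Some (nu' d) by rewrite /f valK.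
have mem_t d : d \in t.
  rewrite mem_cat mem_filter mem_enum andbT orbC; case: (boolP (ch d)) => //= chd.
  rewrite -[d]/(val (exist (fun d => ch d) d chd)) map_f // (perm_mem perm_t).
  by rewrite mem_enum.
exists f, (index^~ t); split=> [d d' eq_i|d s|].
- by rewrite -(nth_index d (mem_t d)) eq_i nth_index.
- rewrite /f; case: insubP => //= -[u chu] _ /= <- [<-].
  by exists chu; apply: nu'P.
rewrite -nu'_t1 size_map; split=> [i s0 lt_i|d chd].
  case: t1 => [|d0 t1'] in nu'_t1 perm_t t mem_t lt_i *; first by [].
  set t1 := d0 :: t1' in nu'_t1 perm_t t mem_t lt_i *.
  exists (val (nth d0 t1 i)); split; first exact: valP.
    have uniq_t1: uniq (t1 ++ t2) by rewrite (perm_uniq perm_t) enum_uniq.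
    rewrite index_cat map_f ?mem_cat ?mem_nth // index_map; last exact: val_inj.
    rewrite index_cat mem_nth //.
    by apply/eqP/index_uniq => //; move: uniq_t1; rewrite cat_uniq => /andP[].
  by rewrite f_val (nth_map d0).
pose u : {d : D | ch d} := exist _ d chd.
have : u \in t1 ++ t2 by rewrite (perm_mem perm_t) mem_enum.
rewrite mem_cat; case: (boolP (u \in t1)) => /= [t1u _|_ t2u]; [left | right].
  exists (index u t1); first by rewrite index_mem.
  rewrite -[index d t]/(index (val u) t) index_cat map_f ?mem_cat ?t1u //.
  by rewrite index_map ?index_cat ?t1u //; apply: val_inj.
by exists (nu' u); [exact: nu'_t2 | rewrite -[d]/(val u) f_val].
Qed.

End LocalSteps.

(** * Infinite branches and their prefixes *)

Section Branches.
Variables (D : Type) (t : tree D).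

Lemma node_cat (m m' : seq D) : t (m ++ m') -> t m.
Proof.
elim/last_ind: m' => [|m' d IH]; first by rewrite cats0.
by rewrite -rcons_cat => t_m; apply/IH/(node_prefix t_m).
Qed.

Lemma node_take (m : seq D) i : t m -> t (take i m).
Proof. by rewrite -{1}(cat_take_drop i m); apply: node_cat. Qed.

Lemma size_branch n b i : infinite_branch t n b -> size (b i) = size n + i.
Proof.
case=> b0 _ b_next; elim: i => [|i IH]; first by rewrite b0 addn0.
by have [d ->] := b_next i; rewrite size_rcons IH addnS.
Qed.

Lemma take_branch n b i j k :
  infinite_branch t n b -> k <= size n + i -> i <= j ->
  take k (b j) = take k (b i).
Proof.
move=> br_b le_k; elim: j => [|j IH]; first by rewrite leqn0 => /eqP->.
rewrite leq_eqVlt => /orP[/eqP-> //|]; rewrite ltnS => le_ij.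
have [_ _ b_next] := br_b; have [d ->] := b_next j.
rewrite -IH // -cats1 takel_cat // (size_branch _ br_b).
by rewrite (leq_trans le_k) // leq_add2l.
Qed.

Lemma branch_shift n b i : infinite_branch t n b ->
  infinite_branch t (b i) (fun j => b (i + j)).
Proof. by case=> _ tb b_next; split=> [|j|j]; rewrite ?addn0 ?addnS. Qed.

(** [take i (b i)] runs first through the prefixes of [n] and then through [b] itself. *)
Lemma infinite_branch_extend (n : seq D) (b : nat -> seq D) :
  infinite_branch t n b ->
  exists2 b', infinite_branch t [::] b' & forall i, b' (size n + i) = b i.
Proof.
move=> br_b; have [b0 tb b_next] := br_b.
exists (fun i => take i (b i)) => [|i].
  split=> [|i|i]; rewrite ?take0 ?node_take //.
  have [d b_i1] := b_next i.
  have lt_i : i < size (b i.+1) by rewrite (size_branch _ br_b) addnS ltnS leq_addl.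
  exists (nth d (b i.+1) i); rewrite (take_nth d) //.
  by rewrite (@take_branch n b i i.+1) // leq_addl.
rewrite (@take_branch n b i) ?leq_addl //.
by rewrite -(size_branch i br_b) take_size.
Qed.

End Branches.

(** Pigeonhole: otherwise each [x] has a bound [N x] from which on it never occurs, and no value is
    left at the maximum of these bounds. *)
Lemma infinitely_often_fin (I : finType) (P : nat -> I -> Prop) :
  (forall i, exists x, P i x) -> exists x, infinitely_often (P^~ x).
Proof.
move=> exP; apply: contrapT => /forallNP none.
have /choice[N NP] x : exists N, forall j, N <= j -> ~ P j x.
  have /existsNP[N NP] := none x; exists N => j le_j Pj.
  by apply: NP; exists j.
have [x Px] := exP (\max_x N x).
exact: (NP x _ (leq_bigmax x)) Px.
Qed.

(** * Executions as labellings of the input tree *)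

Section Annotations.
Variables (Sigma : finType) (A : aapta Sigma) (D : finType) (T : ltree D Sigma).
Local Notation Q := (state A).

(** The interface between automaton and formula. Parity is stated negatively and for branches from
    any node [n]: starting late discards the finitely many visits to priorities below the least
    recurrent one. *)
Record annotation (lab : seq D -> pred Q) (mark : seq D -> pred nat) : Prop := {
  annot_init : lab [::] (init A);
  annot_lab_inj : forall m q q', T m -> lab m q -> lab m q' -> q = q';
  annot_mark_inj : forall m i j, T m -> i < delta_E A -> j < delta_E A ->
    mark m i -> mark m j -> i = j;
  annot_mark_uniq : forall m d d' i, T (rcons m d) -> T (rcons m d') ->
    i < delta_E A -> mark (rcons m d) i -> mark (rcons m d') i -> d = d';
  annot_step : forall m q, T m -> lab m q ->
    step (fun d => T (rcons m d)) (fun d => lab (rcons m d))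
      (fun d => mark (rcons m d)) (delta q (label T m));
  annot_parity : forall n b k, odd k -> infinite_branch T n b ->
    (forall i, exists2 q, lab (b i) q & k <= prio q) ->
    ~ infinitely_often (fun i => exists2 q, lab (b i) q & prio q = k)
}.

Lemma delta_E_max q sigma :
  pbf_max (fun p => msize (euE p)) (delta (a := A) q sigma) <= delta_E A.
Proof.
apply: leq_trans (leq_bigmax q).
exact: (leq_bigmax (F := fun sigma => pbf_max _ (delta q sigma)) sigma).
Qed.

Lemma exec_pos_rcons (x : seq (D * Q)) d q : exec_pos (rcons x (d, q)) = rcons (exec_pos x) d.
Proof. by rewrite /exec_pos /unzip1 map_rcons. Qed.

Lemma exec_state_rcons (x : seq (D * Q)) d q : exec_state (rcons x (d, q)) = q.
Proof. by rewrite /exec_state /unzip2 map_rcons last_rcons. Qed.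

Lemma eq_annotation lab lab' mark mark' :
  (forall m, T m -> lab m =1 lab' m) ->
  (forall m i, T m -> i < delta_E A -> mark m i = mark' m i) ->
  annotation lab mark -> annotation lab' mark'.
Proof.
move=> eq_lab eq_mark ann; split.
- by rewrite -eq_lab ?node_root //; apply: annot_init ann.
- by move=> m q q' Tm; rewrite -!eq_lab //; apply: (annot_lab_inj ann).
- by move=> m i j Tm ? ?; rewrite -!eq_mark //; apply: (annot_mark_inj ann).
- by move=> m d d' i ? ? ?; rewrite -!eq_mark //; apply: (annot_mark_uniq ann).
- move=> m q Tm; rewrite -eq_lab // => /(annot_step ann Tm).
  by apply: eq_step (delta_E_max _ _) => d; [apply: eq_lab | move=> i; apply: eq_mark].
move=> n b k odd_k br_b ge_k inf_k; have [_ Tb _] := br_b.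
apply: (annot_parity ann odd_k br_b) => i.
  by have [q] := ge_k i; rewrite -eq_lab //; exists q.
by have [j le_j [q]] := inf_k i; rewrite -eq_lab //; exists j => //; exists q.
Qed.

Section ToLanguage.
Variables (lab : seq D -> pred Q) (mark : seq D -> pred nat).

Fixpoint labelled_along (m : seq D) (x : seq (D * Q)) : bool :=
  if x is (d, q) :: x' then lab (rcons m d) q && labelled_along (rcons m d) x'
  else true.

Lemma labelled_along_rcons m x d q :
  labelled_along m (rcons x (d, q)) =
  labelled_along m x && lab (rcons (m ++ exec_pos x) d) q.
Proof.
elim: x m => [|[d' q'] x IH] m /=; first by rewrite cats0 andbT.
by rewrite IH cat_rcons andbA.
Qed.

(** When labels are unique, this execution has at most one node over each node of the tree. *)
Definition run_pred (x : seq (D * Q)) := T (exec_pos x) && labelled_along [::] x.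

Lemma run_prefix x dq : run_pred (rcons x dq) -> run_pred x.
Proof.
case: dq => d q; rewrite /run_pred exec_pos_rcons labelled_along_rcons.
by case/andP=> Td /andP[-> _]; rewrite (node_prefix Td).
Qed.

Lemma run_root : run_pred [::].
Proof. by rewrite /run_pred node_root. Qed.

Definition run_tree : tree (D * Q) := Tree run_root run_prefix.

Hypothesis ann : annotation lab mark.

Lemma run_lab x : run_tree x -> lab (exec_pos x) (exec_state x).
Proof.
case/lastP: x => [_|x [d q]]; first exact: annot_init ann.
rewrite /= /run_pred labelled_along_rcons exec_pos_rcons exec_state_rcons.
by case/and3P.
Qed.

Lemma annotation_in_language : in_language A T.
Proof.
exists run_tree; split=> [x run_x|b br_b].
  have [Tx lab_x] : T (exec_pos x) /\ labelled_along [::] x by apply/andP.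
  split=> //; apply: step_marking_sat (delta_E_max _ _) _; last first.
  - by apply: (annot_step ann) => //; apply: run_lab.
  - move=> [d Td] s /= lab_s; rewrite inE /= /run_pred exec_pos_rcons Td.
    by rewrite labelled_along_rcons lab_x.
  - by move=> d d' i; apply: (annot_mark_uniq ann).
  - by move=> d i j; apply: (annot_mark_inj ann).
  - by move=> d s s'; apply: (annot_lab_inj ann).
have [b0 run_b b_next] := br_b.
(* There are finitely many states, so some state recurs, hence some priority, and a least recurrent
   priority [k] exists. *)
have [q inf_q] := @infinitely_often_fin _ (fun i q => exec_state (b i) = q)
  (fun i => ex_intro _ _ erefl).
pose seen k := infinitely_often (fun i => prio (exec_state (b i)) = k).
have seen_q : `[<seen (prio q)>].
  by apply/asboolP => i; have [j le_j <-] := inf_q i; exists j.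
have ex_seen : exists k, `[<seen k>] by exists (prio q).
case: (ex_minnP ex_seen) => k /asboolP seen_k min_k; exists k; split=> //.
  by move=> k' seen_k'; apply/min_k/asboolP.
apply/negP => odd_k.
(* Priorities below [k] do not recur, so from [N0] on only priorities at least [k] occur; an odd [k]
   would contradict [annot_parity] on that suffix. *)
have /choice[N NP] (k' : 'I_k) : exists N, forall j, N <= j ->
    prio (exec_state (b j)) <> k'.
  apply: contrapT => /forallNP noN.
  have /asboolP/min_k : seen k'.
    move=> i; have /existsNP[j /not_implyP[le_j /contrapT]] := noN i.
    by exists j.
  by rewrite leqNgt ltn_ord.
pose N0 := \max_k' N k'.
have br_T : infinite_branch T (exec_pos (b N0)) (fun i => exec_pos (b (N0 + i))).
  split=> [|i|i]; first by rewrite addn0.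
    by have /andP[] := run_b (N0 + i).
  rewrite addnS; have [[d q'] ->] := b_next (N0 + i).
  by exists d; rewrite exec_pos_rcons.
apply: (annot_parity ann odd_k br_T) => i.
  exists (exec_state (b (N0 + i))); first exact: run_lab.
  rewrite leqNgt; apply/negP => lt_k.
  apply: (NP (Ordinal lt_k) (N0 + i)) => //.
  by apply: leq_trans (leq_addr _ _); apply: leq_bigmax.
have [j le_j k_j] := seen_k (N0 + i).
exists (j - N0); first by rewrite leq_subRL // (leq_trans _ le_j) ?leq_addr.
rewrite subnKC; last by rewrite (leq_trans _ le_j) ?leq_addr.
by exists (exec_state (b j)) => //; apply: run_lab.
Qed.

End ToLanguage.

Section FromLanguage.
Variables (U : tree (D * Q)) (F : seq (D * Q) -> (D -> option Q) * (D -> nat)).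
Hypothesis exec_U : execution_tree T U.
Hypothesis acc_U : accepting U.
Hypothesis F_inj : forall x, U x -> injective (F x).2.
Hypothesis F_node : forall x d q, U x -> (F x).1 d = Some q -> U (rcons x (d, q)).
Hypothesis F_step : forall x, U x ->
  step (fun d => T (rcons (exec_pos x) d)) (fun d q => (F x).1 d == Some q)
    (fun d i => (F x).2 d == i) (delta (exec_state x) (label T (exec_pos x))).

(* [None] once the execution has stopped, which only [PTop] allows. *)
Definition exec_node (m : seq D) : option (seq (D * Q)) :=
  foldl (fun o d => obind (fun x => omap (fun q => rcons x (d, q)) ((F x).1 d)) o)
    (Some [::]) m.

Lemma exec_node_rcons m d : exec_node (rcons m d) =
  obind (fun x => omap (fun q => rcons x (d, q)) ((F x).1 d)) (exec_node m).
Proof. by rewrite /exec_node foldl_rcons. Qed.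

Lemma exec_nodeP m x : exec_node m = Some x -> U x /\ exec_pos x = m.
Proof.
elim/last_ind: m x => [|m d IH] x; first by case=> <-; split; first exact: node_root.
rewrite exec_node_rcons; case Dm: (exec_node m) => [y|] //=.
have [Uy pos_y] := IH _ Dm; case Fd: ((F y).1 d) => [q|] //= [<-].
by rewrite exec_pos_rcons pos_y; split; first exact: F_node.
Qed.

Definition exec_lab (m : seq D) : pred Q :=
  fun q => omap (@exec_state _ A D) (exec_node m) == Some q.

(** The mark of a node is decided by the execution at its parent, hence the removal of the last
    direction; the root has no mark. *)
Definition exec_mark (m : seq D) : pred nat :=
  fun i => if rev m is d :: m' then
    if exec_node (rev m') is Some x then (F x).2 d == i else false
  else false.

Lemma exec_mark_rcons m d i : exec_mark (rcons m d) i =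
  if exec_node m is Some x then (F x).2 d == i else false.
Proof. by rewrite /exec_mark rev_rcons revK. Qed.

(** Following only the choices in [F] prunes [U] to at most one state per tree node. Infinite paths
    of the pruned execution lie in [U], so acceptance is inherited. *)
Lemma exec_annotation : annotation exec_lab exec_mark.
Proof.
split.
- by apply/eqP.
- by move=> m q q' _; rewrite /exec_lab => /eqP-> /eqP[].
- move=> m i j _ _ _; rewrite /exec_mark; case: (rev m) => // d m'.
  by case: exec_node => // x /eqP<- /eqP.
- move=> m d d' i _ _ _; rewrite !exec_mark_rcons.
  case Dm: (exec_node m) => [x|] // /eqP<- /eqP eq_d.
  by have [Ux _] := exec_nodeP Dm; apply: esym; apply: F_inj Ux _ _ eq_d.
- move=> m q Tm; rewrite /exec_lab; case Dm: (exec_node m) => [x|] //= /eqP[<-].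
  have [Ux pos_x] := exec_nodeP Dm; have := F_step Ux; rewrite pos_x.
  apply: eq_step (delta_E_max _ _) => [d _ s|d i _ _].
    rewrite exec_node_rcons Dm /=.
    by case: ((F x).1 d) => //= s'; rewrite exec_state_rcons.
  by rewrite exec_mark_rcons Dm.
move=> n b k odd_k br_b ge_k inf_k; have [b0 Tb b_next] := br_b.
(* All nodes of [b] are labelled, so [exec_node] is never [None] there and the default is never
   taken. *)
pose x i := odflt [::] (exec_node (b i)).
have Dx i : exec_node (b i) = Some (x i).
  rewrite /x; have [q] := ge_k i; rewrite /exec_lab.
  by case: (exec_node (b i)).
have lab_b i q : exec_lab (b i) q -> exec_state (x i) = q.
  by rewrite /exec_lab Dx => /eqP[].
have br_x : infinite_branch U (x 0) x.
  split=> // [i|i]; first by have [] := exec_nodeP (Dx i).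
  have [d b_i1] := b_next i; have := Dx i.+1.
  rewrite b_i1 exec_node_rcons Dx /=.
  by case: ((F (x i)).1 d) => //= q [<-]; exists (d, q).
(* Acceptance concerns branches from the root. The least recurrent priority [l] turns out to be [k]:
   all priorities on [b] are at least [k], and [k] recurs. *)
have [y br_y y_x] := infinite_branch_extend br_x.
have [l [inf_l min_l even_l]] := acc_U br_y.
have ge_l : k <= l.
  have [j le_j <-] := inf_l (size (x 0)).
  rewrite -(subnKC le_j) y_x.
  by have [q /lab_b->] := ge_k (j - size (x 0)).
have le_l : l <= k.
  apply: min_l => i; have [j le_j [q /lab_b lab_q prio_q]] := inf_k i.
  exists (size (x 0) + j); first by rewrite (leq_trans le_j) ?leq_addl.
  by rewrite y_x lab_q.
by move: even_l; rewrite (_ : l = k) ?odd_k //; apply/eqP; rewrite eqn_leq le_l.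
Qed.

End FromLanguage.

Lemma in_languageP : non_alternating A ->
  in_language A T <-> exists lab mark, annotation lab mark.
Proof.
move=> nonalt; split=> [[U [exec_U acc_U]]|[lab [mark]]]; last first.
  exact: annotation_in_language.
have /choice[F FP] x : exists fg : (D -> option Q) * (D -> nat), U x ->
    [/\ injective fg.2, forall d q, fg.1 d = Some q -> U (rcons x (d, q))
      & step (fun d => T (rcons (exec_pos x) d)) (fun d q => fg.1 d == Some q)
          (fun d i => fg.2 d == i) (delta (exec_state x) (label T (exec_pos x)))].
  (* Outside [U] a dummy value is chosen. *)
  have [Ux|nUx] := pselect (U x); last by exists (fun=> None, fun=> 0).
  have [_ sat_x] := exec_U x Ux.
  have [f [g [g_inj f_nu fg_step]]] := marking_sat_step (nonalt _ _) sat_x.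
  exists (f, g) => _; split=> //= d q /f_nu[Td].
  by rewrite inE.
exists (exec_lab F), (exec_mark F); apply: (@exec_annotation U) => //.
- by move=> x /FP[].
- by move=> x d q /FP[_ + _]; apply.
- by move=> x /FP[].
Qed.

End Annotations.

(** * Branches visiting a set infinitely often *)

Section RecurrentBranch.
Variables (D : Type) (t : tree D).

Lemma leafless_branch n : leafless t -> t n -> exists b, infinite_branch t n b.
Proof.
move=> leaf_t tn.
have /choice[next nextP] (m : {m | t m}) :
    exists m' : {m | t m}, exists d, val m' = rcons (val m) d.
  have [d t_d] := leaf_t _ (valP m).
  by exists (exist _ (rcons (val m) d) t_d); exists d.
exists (fun i => val (iter i next (exist _ n tn))); split=> // i.
  exact: valP.
exact: nextP.
Qed.

Variables P F : seq D -> Prop.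

Definition until (n : seq D) : Prop :=
  exists b, infinite_branch t n b /\ exists i, F (b i) /\ forall j, j < i -> P (b j).

(** Finite paths of explicit length can be concatenated, unlike the whole infinite branches named by
    [until]. *)
Fixpoint reach (i : nat) (m : seq D) : Prop :=
  if i is i'.+1 then P m /\ exists d, t (rcons m d) /\ reach i' (rcons m d)
  else F m.

Lemma until_reach n : until n -> exists i, reach i n.
Proof.
case=> b [br_b [i [F_i P_lt]]]; exists i.
elim: i => [|i IH] in n b br_b F_i P_lt *.
  by case: br_b F_i => -> _ _.
have [b0 tb b_next] := br_b; have [d b_1] := b_next 0; rewrite b0 in b_1.
split; first by rewrite -b0; apply: P_lt.
exists d; rewrite -b_1; split=> //; apply: (IH _ (fun j => b j.+1)) => // j lt_j.
exact: P_lt.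
Qed.

(** Dependent choice on pairs of a node and a remaining distance to [F]: a positive distance
    decreases along the path, and at distance [0] a new path starts from a child. *)
Lemma recurrent_branch m0 :
  (forall m, t m -> F m -> exists d, t (rcons m d) /\ until (rcons m d)) ->
  t m0 -> until m0 ->
  exists b, [/\ infinite_branch t m0 b, forall i, P (b i) \/ F (b i)
              & infinitely_often (fun i => F (b i))].
Proof.
move=> F_next tm0 /until_reach[i0 reach0].
pose X := {x : seq D * nat | t x.1 /\ reach x.2 x.1}.
have /choice[next nextP] (x : X) : exists y : X,
    (exists d, (sval y).1 = rcons (sval x).1 d) /\
    ((sval x).2 = 0 \/ (sval x).2 = (sval y).2.+1).
  case: x => -[m [|i]] /= [tm]; last first.
    by case=> _ [d [td reach_d]]; exists (exist _ (_, i) (conj td reach_d));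
      split; [exists d | right].
  case/(F_next m tm) => d [td /until_reach[i reach_d]].
  by exists (exist _ (_, i) (conj td reach_d)); split; [exists d | left].
pose s i := iter i next (exist _ (m0, i0) (conj tm0 reach0) : X).
have F0 i : (sval (s i)).2 = 0 -> F (sval (s i)).1.
  by have [_] := svalP (s i) => + eq0; rewrite eq0.
exists (fun i => (sval (s i)).1); split.
- split=> // i; first by case: (svalP (s i)).
  by case: (nextP (s i)).
- move=> i; case eq0: (sval (s i)).2 => [|k]; first by right; apply: F0.
  by left; have [_] := svalP (s i); rewrite eq0 => -[].
move=> i; suff [j le_j eq0] : exists2 j, i <= j & (sval (s j)).2 = 0.
  by exists j => //; apply: F0.
(* Induction on the remaining distance at time [i]. *)
elim: {i}(sval (s i)).2 {-2}i (erefl (sval (s i)).2) => [|k IH] i eq_k.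
  by exists i.
have [_] := nextP (s i); rewrite eq_k => -[//|[eq_k']].
by have [j /ltnW le_j eq0] := IH i.+1 (esym eq_k'); exists j.
Qed.

End RecurrentBranch.

(** * Derived connectives, their sizes and their semantics *)

Section Connectives.
Variables (V : eqType) (x0 : V).
Local Notation F := (qctl V).

Definition QTrue : F := QOr (QVar x0) (QNot (QVar x0)).
Definition QAnd (f g : F) : F := QNot (QOr (QNot f) (QNot g)).
Definition QImp (f g : F) : F := QOr (QNot f) g.
Definition QAX (f : F) : F := QNot (QEX (QNot f)).
Definition QEF (f : F) : F := QEU QTrue f.
Definition QAG (f : F) : F := QNot (QEF (QNot f)).

Variable I : eqType.
Implicit Types (s : seq I) (f : I -> F).

Definition QAll s f : F := foldr (fun i => QAnd (f i)) QTrue s.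
Definition QAny s f : F := foldr (fun i => QOr (f i)) (QNot QTrue) s.

Lemma is_ctl_all s f : (forall i, is_ctl (f i)) -> is_ctl (QAll s f).
Proof. by move=> ctl_f; elim: s => //=. Qed.

Lemma is_ctl_any s f : (forall i, is_ctl (f i)) -> is_ctl (QAny s f).
Proof. by move=> ctl_f; elim: s => //=. Qed.

(** Each item pays 4 for the encoded conjunction; the final 4 is the size of [QTrue]. *)
Lemma qctl_size_all c s f : (forall i, qctl_size (f i) <= c) ->
  qctl_size (QAll s f) <= size s * (c + 4) + 4.
Proof.
move=> le_c; elim: s => //= i s; rewrite -/(QAll s f) => IH.
by have := le_c i; lia.
Qed.

Lemma qctl_size_any c s f : (forall i, qctl_size (f i) <= c) ->
  qctl_size (QAny s f) <= size s * c.+1 + 5.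
Proof.
move=> le_c; elim: s => //= i s; rewrite -/(QAny s f) => IH.
by have := le_c i; lia.
Qed.

Variables (D : Type) (t : tree D) (v : seq D -> pred V).
Implicit Types n : seq D.

Lemma qsat_true n : qsat t v n QTrue.
Proof. by move=> /=; case: (v n x0); [left | right]. Qed.

Lemma qsat_false n : ~ qsat t v n (QNot QTrue).
Proof. by apply; apply: qsat_true. Qed.

Lemma qsat_not n (f : F) : qsat t v n (QNot f) <-> ~ qsat t v n f.
Proof. by []. Qed.

Lemma qsat_or n (f g : F) : qsat t v n (QOr f g) <-> qsat t v n f \/ qsat t v n g.
Proof. by []. Qed.

Lemma qsat_EX n (f : F) :
  qsat t v n (QEX f) <-> exists d, t (rcons n d) /\ qsat t v (rcons n d) f.
Proof. by []. Qed.

Lemma qsat_and n (f g : F) : qsat t v n (QAnd f g) <-> qsat t v n f /\ qsat t v n g.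
Proof.
split=> [/= nor|[sat_f sat_g] [//|//]].
by split; apply: contrapT => ?; apply: nor; [left | right].
Qed.

Lemma qsat_imp n (f g : F) : qsat t v n (QImp f g) <-> (qsat t v n f -> qsat t v n g).
Proof.
split=> /= [[//|//]|imp].
by have [/imp|] := pselect (qsat t v n f); [right | left].
Qed.

Lemma qsat_AX n (f : F) :
  qsat t v n (QAX f) <-> forall d, t (rcons n d) -> qsat t v (rcons n d) f.
Proof.
split=> /= [noEX d td|ax [d [td nf]]]; last exact/nf/ax.
by apply: contrapT => nf; apply: noEX; exists d.
Qed.

Lemma qsat_all n s f :
  qsat t v n (QAll s f) <-> {in s, forall i, qsat t v n (f i)}.
Proof.
elim: s => [|i s IH] /=; first by split=> // _; apply: qsat_true.
rewrite -/(QAll s f); split=> [/qsat_and[sat_i /IH sat_s] j|sat_f].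
  by rewrite inE => /predU1P[->|/sat_s].
apply/qsat_and; split; first by apply: sat_f; rewrite mem_head.
by apply/IH => j s_j; apply: sat_f; rewrite inE s_j orbT.
Qed.

Lemma qsat_any n s f :
  qsat t v n (QAny s f) <-> exists2 i, i \in s & qsat t v n (f i).
Proof.
elim: s => [|i s IH] /=; first by split=> [/qsat_false|[]].
split=> [[sat_i|/IH[j s_j sat_j]]|[j]].
- by exists i; rewrite ?mem_head.
- by exists j; rewrite // inE s_j orbT.
by rewrite inE => /predU1P[->|s_j sat_j]; [left | right; apply/IH; exists j].
Qed.

Hypothesis leaf_t : leafless t.

(** [QEU] ranges over infinite branches only; in a leafless tree every node lies on one that starts
    at the root. *)
Lemma qsat_EF (f : F) :
  qsat t v [::] (QEF f) <-> exists m, t m /\ qsat t v m f.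
Proof.
split=> [[b [[_ tb _] [i [sat_i _]]]]|[m [tm sat_m]]]; first by exists (b i).
have [b br_b] := leafless_branch leaf_t tm.
have [b' br_b' b'_b] := infinite_branch_extend br_b.
exists b'; split=> //; exists (size m); split=> [|j _]; last exact: qsat_true.
by have := b'_b 0; rewrite addn0 => ->; case: br_b => ->.
Qed.

Lemma qsat_AG (f : F) :
  qsat t v [::] (QAG f) <-> forall m, t m -> qsat t v m f.
Proof.
split=> [noEF m tm|sat_f sat_EF]; last first.
  by have [m [tm]] := (qsat_EF (QNot f)).1 sat_EF; apply; apply: sat_f.
by apply: contrapT => nf; apply/noEF/(qsat_EF (QNot f)); exists m.
Qed.

End Connectives.

(** * Quantifier prefixes *)

Section Prefixes.
Variables (V : eqType) (D : Type) (t : tree D).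

Lemma qsat_exists_prefix (ps : seq V) (v : seq D -> pred V) n f :
  qsat t v n (foldr (@QExists V) f ps) ->
  exists v', (forall m p, t m -> p \notin ps -> v' m p = v m p) /\ qsat t v' n f.
Proof.
elim: ps v => [|p ps IH] v /=; first by exists v.
case=> v1 [rel_v1 /IH[v' [eq_v' sat_f]]]; exists v'; split=> // m p' tm.
by rewrite inE negb_or => /andP[ne_p ps'p]; rewrite eq_v' ?rel_v1.
Qed.

(** The variables are switched to [v'] one at a time. Agreement is asked off the tree too, so that
    at the end of the prefix the two valuations are equal functions. *)
Lemma qsat_exists_prefix_intro (ps : seq V) (v v' : seq D -> pred V) n f :
  (forall m p, p \notin ps -> v' m p = v m p) -> qsat t v' n f ->
  qsat t v n (foldr (@QExists V) f ps).
Proof.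
elim: ps v => [|p ps IH] v eq_v' sat_f /=.
  suff -> : v = v' by [].
  by apply/funext => m; apply/funext => p; rewrite eq_v'.
exists (fun m p' => if p' == p then v' m p' else v m p'); split.
  by move=> m _ p' /negbTE->.
apply: IH => // m p' ps'p; case: eqP => // /eqP ne_p.
by rewrite eq_v' // inE negb_or ne_p.
Qed.

Lemma qsat_forall (p : V) (v : seq D -> pred V) n f :
  qsat t v n (QForall p f) <-> forall v', relabelling t p v v' -> qsat t v' n f.
Proof.
split=> /= [noE v' rel_v'|sat_f [v' [rel_v']]]; last by apply; apply: sat_f.
by apply: contrapT => nf; apply: noE; exists v'.
Qed.

End Prefixes.

(** * The formula of an automaton *)

Section Formula.
Variables (AP : finType) (A : aapta {set AP}).
Local Notation Q := (state A).
Local Notation F := (qctl (prop_of AP)).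

(** Index [0] is the test variable, indices [1] to [|Q|+1] encode states, and marks start at
    [|Q|+2], so the families are disjoint. *)
Definition state_var (i : nat) : prop_of AP := inr i.+1.
Definition mark_var (i : nat) : prop_of AP := inr (#|Q|.+2 + i).
Definition test_var : prop_of AP := inr 0.

Local Notation And := (@QAnd (prop_of AP)).
Local Notation Imp := (@QImp (prop_of AP)).
Local Notation AX := (@QAX (prop_of AP)).
Local Notation AG := (QAG test_var).
Local Notation EF := (QEF test_var).
Local Notation All := (QAll test_var).
Local Notation Any := (QAny test_var).
Local Notation Top := (QTrue test_var).
Local Notation Test := (QVar test_var).
Local Notation Mark i := (QVar (mark_var i)).

(* The state of rank [i] is encoded by the truth of exactly the first [i + 1]
   variables [state_var]: unlike one variable per state, this makes the states
   mutually exclusive by a formula of size linear in their number.  A node where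
   the execution has stopped satisfies no [state_var]. *)
Definition state_formula (q : Q) : F :=
  And (QVar (state_var (enum_rank q))) (QNot (QVar (state_var (enum_rank q).+1))).

Definition unary_formula : F :=
  All (iota 0 #|Q|) (fun i => Imp (QVar (state_var i.+1)) (QVar (state_var i))).

(** Quadratic in [delta_E], which the factor [delta_E * (delta_E + delta_U)] of the bound
    absorbs. *)
Definition mark_excl_formula : F :=
  All (iota 0 (delta_E A)) (fun i => All (iota 0 (delta_E A)) (fun j =>
    if i == j then Top else Imp (Mark i) (QNot (Mark j)))).

Definition mark_uniq_formula : F :=
  All (iota 0 (delta_E A)) (fun i =>
    QOr (AX (Imp (Mark i) Test)) (AX (Imp (Mark i) (QNot Test)))).

Definition letter_formula (sigma : {set AP}) : F :=
  All (enum AP) (fun a => if a \in sigma then QVar (inl a) else QNot (QVar (inl a))).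

Definition eupair_formula (p : eupair Q) : F :=
  let l := mset_list (euE p) in
  And (All (iota 0 (size l)) (fun i =>
         QEX (And (Mark i) (state_formula (nth (init A) l i)))))
      (AX (QOr (Any (iota 0 (size l)) (fun i => Mark i))
               (Any (enum (euU p)) state_formula))).

Fixpoint step_formula (b : pbf Q) : F :=
  match b with
  | PTop => Top
  | PBot | PAnd _ _ => QNot Top
  | PEU p => eupair_formula p
  | POr b1 b2 => QOr (step_formula b1) (step_formula b2)
  end.

Definition delta_formula : F :=
  All (enum Q) (fun q => All (enum {set AP}) (fun sigma =>
    Imp (state_formula q) (Imp (letter_formula sigma)
      (step_formula (delta q sigma))))).

Definition prio_ge_formula k : F :=
  Any [seq q <- enum Q | k <= prio q] state_formula.

Definition prio_eq_formula k : F :=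
  Any [seq q <- enum Q | prio q == k] state_formula.

(** The recurrence property, negated. The [QEX] before [QEU] makes the next visit strictly deeper;
    [QEU] alone could be satisfied on the spot. *)
Definition recurrence_formula k : F :=
  QOr (AG (QNot Test))
      (EF (And Test (QNot (QEX (QEU (prio_ge_formula k)
                                    (And (prio_eq_formula k) Test)))))).

Definition parity_formula : F :=
  All [seq k <- undup [seq prio q | q : Q] | odd k] recurrence_formula.

Definition matrix_formula : F :=
  And (state_formula (init A))
    (And (AG (And (And unary_formula mark_excl_formula)
                  (And mark_uniq_formula delta_formula)))
         parity_formula).

Definition bound_vars : seq (prop_of AP) :=
  [seq inr j | j <- iota 1 (#|Q|.+1 + delta_E A)].

Definition automaton_formula : F :=
  foldr (@QExists _) (foldr (@QForall _) matrix_formula [:: test_var]) bound_vars.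

(** * Semantics of the subformulas *)

Section Semantics.
Variables (D : finType) (T : ltree D {set AP}) (v : seq D -> pred (prop_of AP)).
Hypothesis leaf_T : leafless T.
Hypothesis v_AP : forall m a, T m -> v m (inl a) = (a \in label T m).

Definition lab_of (m : seq D) : pred Q := fun q =>
  v m (state_var (enum_rank q)) && ~~ v m (state_var (enum_rank q).+1).

Definition mark_of (m : seq D) : pred nat := fun i => v m (mark_var i).

Lemma qsat_state m q : qsat T v m (state_formula q) <-> lab_of m q.
Proof.
split=> [/qsat_and[/= s_i /negP s_j]|/andP[s_i s_j]]; first exact/andP.
by apply/qsat_and; split=> //=; apply/negP.
Qed.

Lemma qsat_letter m sigma : T m ->
  qsat T v m (letter_formula sigma) <-> sigma = label T m.
Proof.
move=> Tm; split=> [/qsat_all sat_a|-> ]; last first.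
  by apply/qsat_all => a _; case: ifP => /= a_m; rewrite v_AP // a_m.
apply/setP => a; have := sat_a a; rewrite mem_enum => /(_ isT).
by case: ifP => _ /=; rewrite v_AP // => /negP/negbTE->.
Qed.

Lemma qsat_unary m : qsat T v m unary_formula <->
  forall i, i < #|Q| -> v m (state_var i.+1) -> v m (state_var i).
Proof.
split=> [/qsat_all sat_i i lt_i|mono].
  by have := sat_i i; rewrite mem_iota => /(_ lt_i)/qsat_imp.
by apply/qsat_all => i; rewrite mem_iota => /mono lt_i; apply/qsat_imp.
Qed.

Lemma qsat_mark_excl m : qsat T v m mark_excl_formula <->
  forall i j, i < delta_E A -> j < delta_E A -> mark_of m i -> mark_of m j -> i = j.
Proof.
split=> [/qsat_all sat_ij i j lt_i lt_j mark_i mark_j|excl].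
  have := sat_ij i; rewrite mem_iota => /(_ lt_i)/qsat_all/(_ j).
  rewrite mem_iota => /(_ lt_j); case: eqP => // _ /qsat_imp/(_ mark_i).
  by case.
apply/qsat_all => i; rewrite mem_iota => lt_i.
apply/qsat_all => j; rewrite mem_iota => lt_j.
case: eqP => [_|ne_ij]; first exact: qsat_true.
by apply/qsat_imp => mark_i mark_j; apply/ne_ij/excl.
Qed.

Lemma qsat_step m b : qsat T v m (step_formula b) <->
  step (fun d => T (rcons m d)) (fun d => lab_of (rcons m d))
    (fun d => mark_of (rcons m d)) b.
Proof.
elim: b => [||p|b1 _ b2 _|b1 [IH1 IH1'] b2 [IH2 IH2']].
- by split=> // _; apply: qsat_true.
- by split=> [/qsat_false|[]].
- rewrite [step_formula _]/(eupair_formula p) /eupair_formula.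
  set l := mset_list _; rewrite qsat_and qsat_AX /= -/l.
  split=> -[satE satU]; split.
  + move=> i s0 lt_i; move/qsat_all/(_ i): satE; rewrite mem_iota => /(_ lt_i).
    case/qsat_EX=> d [Td /qsat_and[mark_i /qsat_state lab_i]]; exists d; split=> //.
    by rewrite (set_nth_default (init A)).
  + move=> d Td; have /qsat_or[/qsat_any[i]|/qsat_any[q]] := satU d Td.
      by rewrite mem_iota => lt_i mark_i; left; exists i.
    by rewrite mem_enum => Uq /qsat_state lab_q; right; exists q.
  + apply/qsat_all => i; rewrite mem_iota => lt_i.
    have [d [Td mark_i lab_i]] := satE i (init A) lt_i.
    by exists d; split=> //; apply/qsat_and; split=> //; apply/qsat_state.
  move=> d Td; have [[i lt_i mark_i]|[q Uq lab_q]] := satU d Td; [left | right].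
    by apply/qsat_any; exists i; rewrite ?mem_iota.
  by apply/qsat_any; exists q; rewrite ?mem_enum //; apply/qsat_state.
- by split=> [/qsat_false|[]].
by split=> [/qsat_or[/IH1|/IH2]|[/IH1'|/IH2']]; [left | right | left | right].
Qed.

Lemma qsat_delta m : T m -> qsat T v m delta_formula <->
  forall q, lab_of m q -> step (fun d => T (rcons m d))
    (fun d => lab_of (rcons m d)) (fun d => mark_of (rcons m d))
    (delta q (label T m)).
Proof.
move=> Tm; split=> [/qsat_all sat_q q lab_q|step_m].
  have := sat_q q; rewrite mem_enum => /(_ isT)/qsat_all/(_ (label T m)).
  rewrite mem_enum => /(_ isT)/qsat_imp/(_ ((qsat_state _ _).2 lab_q)).
  by move/qsat_imp/(_ ((qsat_letter _ Tm).2 erefl))/qsat_step.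
apply/qsat_all => q _; apply/qsat_all => sigma _.
apply/qsat_imp => /qsat_state lab_q; apply/qsat_imp => /(qsat_letter _ Tm)->.
exact/qsat_step/step_m.
Qed.

Lemma qsat_prio_ge m k : qsat T v m (prio_ge_formula k) <->
  exists2 q, lab_of m q & k <= prio q.
Proof.
split=> [/qsat_any[q]|[q lab_q ge_k]].
  by rewrite mem_filter => /andP[ge_k _] /qsat_state; exists q.
apply/qsat_any; exists q; first by rewrite mem_filter ge_k mem_enum.
exact/qsat_state.
Qed.

Lemma qsat_prio_eq m k : qsat T v m (prio_eq_formula k) <->
  exists2 q, lab_of m q & prio q = k.
Proof.
split=> [/qsat_any[q]|[q lab_q eq_k]].
  by rewrite mem_filter => /andP[/eqP eq_k _] /qsat_state; exists q.
apply/qsat_any; exists q; first by rewrite mem_filter eq_k eqxx mem_enum.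
exact/qsat_state.
Qed.

Lemma qsat_recurrence k : qsat T v [::] (recurrence_formula k) <->
  ((exists2 m, T m & v m test_var) ->
   ~ forall m, T m -> v m test_var -> exists d, T (rcons m d) /\
       until T (fun n => qsat T v n (prio_ge_formula k))
         (fun n => qsat T v n (And (prio_eq_formula k) Test)) (rcons m d)).
Proof.
split=> [/qsat_or[/(qsat_AG _ _ leaf_T) noTest [m Tm test_m] _|]|noRec].
- exact: noTest m Tm test_m.
- move=> /(qsat_EF _ _ leaf_T)[m [Tm /qsat_and[test_m /qsat_not nEX]]] _ rec.
  by apply/nEX/qsat_EX/rec.
have [[m Tm test_m]|noTest] := pselect (exists2 m, T m & v m test_var); last first.
  by apply/qsat_or; left; apply/qsat_AG => // m Tm /= test_m; apply: noTest; exists m.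
apply/qsat_or; right; apply/qsat_EF => //; apply: contrapT => noFail.
apply: noRec => [|m' Tm' test_m']; first by exists m.
apply: contrapT => noNext; apply: noFail; exists m'; split=> //.
by apply/qsat_and.
Qed.

(** If [q] had smaller rank than [q'], truth of the variable at the rank of [q'] would propagate
    down to the one just above the rank of [q], which [q] requires to be false. *)
Lemma unary_lab_inj m q q' :
  (forall i, i < #|Q| -> v m (state_var i.+1) -> v m (state_var i)) ->
  lab_of m q -> lab_of m q' -> q = q'.
Proof.
move=> mono; wlog le_q: q q' / enum_rank q <= enum_rank q'.
  move=> sym lab_q lab_q'; case: (leqP (enum_rank q) (enum_rank q')) => [|/ltnW] le.
    exact: sym.
  exact/esym/sym.
move=> /andP[_ q_max] /andP[q'_in _]; apply/enum_rank_inj/val_inj/eqP.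
rewrite eqn_leq le_q leqNgt; apply/negP => lt_q; case/negP: q_max.
have down j : enum_rank q < j -> j <= #|Q| -> v m (state_var j) ->
    v m (state_var (enum_rank q).+1).
  elim: j => // j IH; rewrite ltnS leq_eqVlt => /predU1P[->//|lt_j] le_j v_j.
  exact/(IH lt_j (ltnW le_j))/mono.
exact: down lt_q (ltnW (ltn_ord _)) q'_in.
Qed.

(** The value of [test_var] in [v] is left arbitrary, as its universal quantification demands. *)
Lemma qsat_matrix :
  (forall m i, T m -> i < #|Q| -> v m (state_var i.+1) -> v m (state_var i)) ->
  annotation T lab_of mark_of -> qsat T v [::] matrix_formula.
Proof.
move=> mono ann; apply/qsat_and; split; first exact/qsat_state/(annot_init ann).
apply/qsat_and; split.
  apply/qsat_AG => // m Tm; apply/qsat_and; split; apply/qsat_and; split.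
  - by apply/qsat_unary => i; apply: mono.
  - by apply/qsat_mark_excl => i j; apply: (annot_mark_inj ann).
  - apply/qsat_all => i; rewrite mem_iota => lt_i.
    (* If some child with mark [i] satisfies [test_var], it is the only child with that mark and the
       first disjunct holds; otherwise the second does. *)
    have [[d [Td [mark_d test_d]]]|none] :=
        pselect (exists d, T (rcons m d) /\ mark_of (rcons m d) i /\
                           v (rcons m d) test_var).
      left; apply/qsat_AX => d' Td'; apply/qsat_imp => mark_d'.
      by rewrite (annot_mark_uniq ann Td' Td lt_i mark_d' mark_d).
    right; apply/qsat_AX => d' Td'; apply/qsat_imp => mark_d' test_d'.
    by apply: none; exists d'.
  by apply/qsat_delta => // q; apply: (annot_step ann).
apply/qsat_all => k; rewrite mem_filter => /andP[odd_k _].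
(* Recurrence would give a branch with all priorities at least [k] on which [k] recurs. *)
apply/qsat_recurrence => -[m Tm test_m] rec; have [d [Td until_d]] := rec m Tm test_m.
have [|b [br_b ge_b eq_b]] := recurrent_branch _ Td until_d.
  by move=> m' Tm' /qsat_and[_]; apply: rec.
apply: (annot_parity ann odd_k br_b) => i.
  case: (ge_b i) => [/qsat_prio_ge[q lab_q ge_k]|/qsat_and[/qsat_prio_eq[q lab_q <-] _]].
    by exists q.
  by exists q.
by have [j le_j /qsat_and[/qsat_prio_eq eq_k _]] := eq_b i; exists j.
Qed.

End Semantics.

(** * Models of the formula are annotations *)

Section Models.
Variables (D : finType) (T : ltree D {set AP}).
Hypothesis leaf_T : leafless T.

Lemma matrix_annotation (v : seq D -> pred (prop_of AP)) :
  (forall m a, T m -> v m (inl a) = (a \in label T m)) ->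
  (forall w, relabelling T test_var v w -> qsat T w [::] matrix_formula) ->
  annotation T (lab_of v) (mark_of v).
Proof.
move=> v_AP sat_w.
pose upd (R : pred (seq D)) n p := if p == test_var then R n else v n p.
have rel_upd R : relabelling T test_var v (upd R).
  by move=> m _ p /negbTE ne_p; rewrite /upd ne_p.
have /qsat_and[/qsat_state lab_init /qsat_and[AG_v _]] :
  qsat T v [::] matrix_formula by apply: sat_w.
have local m : T m -> _ := (qsat_AG _ _ leaf_T _).1 AG_v m.
split=> //.
- move=> m q q' Tm; have /qsat_and[/qsat_and[/qsat_unary mono _] _] := local m Tm.
  exact: unary_lab_inj mono.
- move=> m i j Tm; have /qsat_and[/qsat_and[_ /qsat_mark_excl excl] _] := local m Tm.
  exact: excl.
(* With [test_var] true at [rcons m d] only, agreement of the siblings with mark [i] forces [d'] to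
   be [d]. *)
- move=> m d d' i Td Td' lt_i mark_d mark_d'; have Tm := node_prefix Td.
  have /qsat_and[_ /qsat_and[AG_w _]] := sat_w _ (rel_upd (pred1 (rcons m d))).
  have /qsat_and[_ /qsat_and[/qsat_all/(_ i) uniq_i _]] :=
    (qsat_AG _ _ leaf_T _).1 AG_w m Tm.
  move: uniq_i; rewrite mem_iota => /(_ lt_i)/qsat_or[/qsat_AX/(_ d' Td')|/qsat_AX/(_ d Td)].
    by move/qsat_imp/(_ mark_d')/eqP/rcons_inj => -[].
  by move/qsat_imp/(_ mark_d)/qsat_not; case; apply: eqxx.
- move=> m q Tm; have /qsat_and[_ /qsat_and[_ /(qsat_delta v_AP Tm)]] := local m Tm.
  exact.
move=> n b k odd_k br_b ge_k inf_k; have [b0 Tb b_next] := br_b.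
(* [test_var] is put on the nodes of [b] of priority [k]; each reaches a later one along [b],
   through priorities at least [k]. *)
pose R m := `[< exists i, m = b i /\ exists2 q, lab_of v (b i) q & prio q = k >].
have /qsat_and[_ /qsat_and[_ /qsat_all/(_ k)]] := sat_w _ (rel_upd R).
(* A state of priority [k] on [b] shows that [k] is among the priorities over which [parity_formula]
   ranges. *)
have [i0 _ [q0 lab_q0 prio_q0]] := inf_k 0.
rewrite mem_filter odd_k mem_undup -prio_q0 map_f ?mem_enum // prio_q0.
move=> /(_ isT)/(qsat_recurrence _ leaf_T); apply.
  by exists (b i0) => //; apply/asboolP; exists i0; split=> //; exists q0.
move=> _ _ /asboolP[i [-> _]]; have [d b_i1] := b_next i.
exists d; rewrite -b_i1; split=> //; exists (fun j => b (i.+1 + j)); split.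
  exact: branch_shift br_b.
have [j le_j [q lab_q prio_q]] := inf_k i.+1.
exists (j - i.+1); rewrite subnKC //; split=> [|j' _]; last exact/qsat_prio_ge/ge_k.
apply/qsat_and; split; first by apply/qsat_prio_eq; exists q.
by apply/asboolP; exists j; split=> //; exists q.
Qed.

Lemma models_automaton_formula :
  models T [::] automaton_formula <-> exists lab mark, annotation (A := A) T lab mark.
Proof.
split=> [/qsat_exists_prefix[v [eq_v /qsat_forall sat_v]]|[lab [mark ann]]].
  exists (lab_of v), (mark_of v); apply: matrix_annotation => // m a Tm.
  by rewrite eq_v //; apply/mapP => -[].
(* Because of the shift in [i.+1], state variables are the [i] up to [|Q|], and mark [j] is
   [i = |Q|+1+j]. Marks from [delta_E] on are made false, so that [v] changes bound variables
   only. *)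
pose v m (p : prop_of AP) := match p with
  | inl a => a \in label T m
  | inr 0 => false
  | inr i.+1 => if i <= #|Q| then
        if [pick q | lab m q] is Some q then i <= enum_rank q else false
      else (i - #|Q|.+1 < delta_E A) && mark m (i - #|Q|.+1)
  end.
apply: (@qsat_exists_prefix_intro _ _ _ _ _ v) => [m [a|[|i]] //= |].
  rewrite mem_map; last by move=> ? ? [].
  rewrite mem_iota /= add1n ltnS -leqNgt => out.
  have lt_i := leq_trans (leq_addr _ _) out.
  by rewrite leqNgt lt_i ltnNge leq_subRL ?out.
apply/qsat_forall => w rel_w.
(* [w] follows [v] only at nodes and off [test_var], which determines all that an annotation
   uses. *)
have wE m p : T m -> p != test_var -> w m p = v m p by move=> Tm; apply: rel_w.
have w_state m i : T m -> i <= #|Q| -> w m (state_var i) =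
    if [pick q | lab m q] is Some q then i <= enum_rank q else false.
  by move=> Tm le_i; rewrite wE //= le_i.
apply: qsat_matrix => //.
- by move=> m a Tm; rewrite wE.
- move=> m i Tm lt_i; rewrite !w_state // 1?ltnW //.
  by case: pickP => // q _ /ltnW.
apply: eq_annotation (ann) => [m Tm q|m i Tm lt_i].
  rewrite /lab_of !w_state // 1?ltnW //.
  case: pickP => [q' lab_q'|-> //]; rewrite -leqNgt -eqn_leq.
  apply/idP/eqP => [lab_q|eq_q].
    by rewrite (annot_lab_inj ann Tm lab_q lab_q').
  by rewrite (enum_rank_inj (val_inj eq_q)).
rewrite /mark_of wE //= ifF ?addSn ?ltnNge ?leq_addr //.
by rewrite subSS addKn -ltnNge lt_i.
Qed.

End Models.

(** * Shape and size of the formula *)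

Lemma is_EQCTL2_automaton_formula : is_EQCTL2 automaton_formula.
Proof.
exists bound_vars, [:: test_var], matrix_formula; split=> //.
have ctl_step b : is_ctl (step_formula b).
  elim: b => //= p; do !split; try exact: is_ctl_any.
  by apply: is_ctl_all.
have ctl_unary : is_ctl unary_formula by apply: is_ctl_all.
have ctl_excl : is_ctl mark_excl_formula.
  by apply: is_ctl_all => i; apply: is_ctl_all => j; case: eqP.
have ctl_uniq : is_ctl mark_uniq_formula by apply: is_ctl_all.
have ctl_letter sigma : is_ctl (letter_formula sigma).
  by apply: is_ctl_all => a; case: ifP.
have ctl_delta : is_ctl delta_formula.
  by apply: is_ctl_all => q; apply: is_ctl_all => sigma; do !split.
have ctl_prio_ge k : is_ctl (prio_ge_formula k) by apply: is_ctl_any.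
have ctl_prio_eq k : is_ctl (prio_eq_formula k) by apply: is_ctl_any.
have ctl_parity : is_ctl parity_formula.
  by apply: is_ctl_all => k; do !split.
by do !split.
Qed.

Lemma size_eupair p :
  qctl_size (eupair_formula p) <= 32 * (msize (euE p) + #|euU p|).+1.
Proof.
rewrite /eupair_formula -size_mset_list; set l := mset_list _.
(* [state_formula] has size 7; its conjunction with a mark under [QEX] has size 13. *)
have size_E := @qctl_size_all _ test_var _ 13 (iota 0 (size l))
  (fun i => QEX (And (Mark i) (state_formula (nth (init A) l i)))) (fun=> leqnn _).
have size_M := @qctl_size_any _ test_var _ 1 (iota 0 (size l))
  (fun i => Mark i) (fun=> leqnn _).
have size_U := @qctl_size_any _ test_var _ 7 (enum (euU p)) state_formula (fun=> leqnn _).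
move: size_E size_M size_U; rewrite size_iota -cardE /=.
lia.
Qed.

Lemma size_step b X Y :
  pbf_max (fun p => msize (euE p)) b <= X -> pbf_max (fun p => #|euU p|) b <= Y ->
  qctl_size (step_formula b) <= pbf_size b * (32 * (X + Y).+1).
Proof.
elim: b => [||p|b1 _ b2 _|b1 IH1 b2 IH2].
- by move=> _ _ /=; lia.
- by move=> _ _ /=; lia.
- move=> le_X le_Y; rewrite mul1n; apply: leq_trans (size_eupair p) _.
  by rewrite leq_mul2l /= ltnS leq_add.
- by move=> _ _ /=; lia.
rewrite /= !geq_max => /andP[le_X1 le_X2] /andP[le_Y1 le_Y2].
by move: (IH1 le_X1 le_Y1) (IH2 le_X2 le_Y2); lia.
Qed.

Lemma delta_B_max q sigma : pbf_size (delta (a := A) q sigma) <= delta_B A.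
Proof.
apply: leq_trans (leq_bigmax q).
exact: (leq_bigmax (F := fun sigma => pbf_size (delta q sigma)) sigma).
Qed.

Lemma delta_U_max q sigma :
  pbf_max (fun p => #|euU p|) (delta (a := A) q sigma) <= delta_U A.
Proof.
apply: leq_trans (leq_bigmax q).
exact: (leq_bigmax (F := fun sigma => pbf_max _ (delta q sigma)) sigma).
Qed.

Lemma size_unary : qctl_size unary_formula <= #|Q| * 8 + 4.
Proof.
apply: (leq_trans (qctl_size_all (c := 4) _ _ _)) => [//|].
by rewrite size_iota.
Qed.

Lemma size_mark_excl :
  qctl_size mark_excl_formula <= delta_E A * (delta_E A * 9 + 8) + 4.
Proof.
apply: (leq_trans (qctl_size_all (c := delta_E A * 9 + 4) _ _ _)) => [i|].
  apply: (leq_trans (qctl_size_all (c := 5) _ _ _)) => [j|]; first by case: eqP.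
  by rewrite size_iota.
by rewrite size_iota; lia.
Qed.

Lemma size_mark_uniq : qctl_size mark_uniq_formula <= delta_E A * 20 + 4.
Proof.
apply: (leq_trans (qctl_size_all (c := 16) _ _ _)) => [//|].
by rewrite size_iota.
Qed.

Lemma size_delta : qctl_size delta_formula <=
  #|Q| * (2 ^ #|AP| *
    (#|AP| * 6 + delta_B A * (32 * (delta_E A + delta_U A).+1) + 19) + 8) + 4.
Proof.
have size_letter sigma : qctl_size (letter_formula sigma) <= #|AP| * 6 + 4.
  apply: (leq_trans (qctl_size_all (c := 2) _ _ _)) => [a|]; first by case: ifP.
  by rewrite -cardE.
pose c := #|AP| * 6 + delta_B A * (32 * (delta_E A + delta_U A).+1) + 15.
apply: (leq_trans (qctl_size_all (c := 2 ^ #|AP| * (c + 4) + 4) _ _ _)) => [q|].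
  apply: (leq_trans (qctl_size_all (c := c) _ _ _)) => [sigma|].
    have size_d : qctl_size (step_formula (delta q sigma)) <=
        delta_B A * (32 * (delta_E A + delta_U A).+1).
      apply: leq_trans (size_step (delta_E_max _ _) (delta_U_max _ _)) _.
      by rewrite leq_mul2r delta_B_max orbT.
    move: (size_letter sigma) size_d; rewrite /c /=; lia.
  by rewrite -cardE -[#|AP|]cardsT -card_powerset powersetT cardsT.
by rewrite -cardE /c -!addnA; apply: leqnn.
Qed.

(** Each odd priority costs a formula linear in [|Q|], whence the summand [#|Q| * num_prio A]. *)
Lemma size_parity :
  qctl_size parity_formula <= num_prio A * (#|Q| * 16 + 42) + 4.
Proof.
apply: (leq_trans (qctl_size_all (c := #|Q| * 16 + 38) _ _ _)) => [k|]; last first.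
  rewrite leq_add2r leq_mul //; last by lia.
  by rewrite size_filter count_size.
have size_states (P : pred Q) :
    qctl_size (Any [seq q <- enum Q | P q] state_formula) <= #|Q| * 8 + 5.
  apply: (leq_trans (qctl_size_any (c := 7) _ _ _)) => [//|].
  by rewrite leq_add2r leq_mul2r /= size_filter cardE count_size.
have := size_states (fun q => k <= prio q).
have := size_states (fun q => prio q == k).
rewrite -/(prio_ge_formula k) -/(prio_eq_formula k) /=; lia.
Qed.

(** [maxn 1] keeps the product positive when [|AP|] or [delta_E] is zero, since the transition
    formulas still have positive size then. *)
Lemma size_automaton_formula :
  qctl_size automaton_formula <= 1000 *
    (#|Q| * num_prio A
     + #|Q| * 2 ^ #|AP| * maxn 1 #|AP| * delta_B A
       * maxn 1 (delta_E A) * maxn 1 (delta_E A + delta_U A)).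
Proof.
have size_prefix ps (f : F) :
    qctl_size (foldr (@QExists _) f ps) = size ps + qctl_size f.
  by elim: ps => //= p ps ->.
rewrite /automaton_formula size_prefix size_map size_iota /=.
have Q_gt0 : 0 < #|Q| by apply/card_gt0P; exists (init A).
have W_gt0 : 0 < num_prio A.
  rewrite lt0n size_eq0; apply/eqP => /undup_nil/(congr1 size)/eqP.
  by rewrite size_map -cardE -leqn0 leqNgt Q_gt0.
have B_gt0 : 0 < delta_B A.
  by apply: leq_trans (delta_B_max (init A) set0); case: (delta _ _).
have S_gt0 : 0 < 2 ^ #|AP| by rewrite expn_gt0.
have := size_unary; have := size_mark_excl; have := size_mark_uniq.
have := size_delta; have := size_parity.
move: (qctl_size unary_formula) (qctl_size mark_excl_formula).
move: (qctl_size mark_uniq_formula) (qctl_size delta_formula).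
move: (qctl_size parity_formula) Q_gt0 W_gt0 B_gt0 S_gt0.
move: #|Q| #|AP| (num_prio A) (delta_B A) (delta_E A) (delta_U A) (2 ^ #|AP|).
move=> Q P W B E U S s1 Q_gt0 W_gt0 B_gt0 S_gt0 s2 s3 s4 s5.
have [P'_gt0 E'_gt0 F'_gt0] : [/\ 0 < maxn 1 P, 0 < maxn 1 E & 0 < maxn 1 (E + U)].
  by rewrite !leq_maxl.
have [P_le E_le F_le] : [/\ P <= maxn 1 P, E <= maxn 1 E & E + U <= maxn 1 (E + U)].
  by rewrite !leq_maxr.
move: (maxn 1 P) (maxn 1 E) (maxn 1 (E + U)) P'_gt0 E'_gt0 F'_gt0 P_le E_le F_le.
move=> P' E' F' P'_gt0 E'_gt0 F'_gt0 P_le E_le F_le.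
(* All factors of the product are at least 1, so replacing some of them by 1 shows that it dominates
   each smaller monomial. *)
have le_K x y z w a b : x <= Q -> y <= S -> z <= P' -> w <= B -> a <= E' -> b <= F' ->
    x * y * z * w * a * b <= Q * S * P' * B * E' * F'.
  by move=> *; rewrite !leq_mul.
(* Needed for the square of [E] contributed by the exclusivity of marks. *)
have E_le_F : E <= F' by lia.
have := le_K 1 1 1 1 E E Q_gt0 S_gt0 P'_gt0 B_gt0 E_le E_le_F.
have := le_K 1 1 1 1 1 E Q_gt0 S_gt0 P'_gt0 B_gt0 E'_gt0 E_le_F.
have := le_K Q S P 1 1 1 (leqnn _) (leqnn _) P_le B_gt0 E'_gt0 F'_gt0.
have := le_K Q S 1 B 1 (E + U) (leqnn _) (leqnn _) P'_gt0 (leqnn _) E'_gt0 F_le.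
have := le_K Q S 1 B 1 1 (leqnn _) (leqnn _) P'_gt0 (leqnn _) E'_gt0 F'_gt0.
have := le_K Q S 1 1 1 1 (leqnn _) (leqnn _) P'_gt0 B_gt0 E'_gt0 F'_gt0.
have := le_K Q 1 1 1 1 1 (leqnn _) S_gt0 P'_gt0 B_gt0 E'_gt0 F'_gt0.
(* Absorbs the constant cost per priority. *)
have W_le : W <= Q * W by rewrite leq_pmull.
move: {le_K}(Q * S * P' * B * E' * F') => K.
rewrite !muln1 !mul1n; lia.
Qed.

End Formula.

Theorem theorem12 :
  exists C : nat,
  forall (AP : finType) (A : aapta {set AP}),
  non_alternating A ->
  exists Phi : qctl (prop_of AP),
    [/\ is_EQCTL2 Phi,
        forall (D : finType) (T : ltree D {set AP}),
          leafless T -> (in_language A T <-> models T [::] Phi)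
      & qctl_size Phi <=
          C * (#|state A| * num_prio A
               + #|state A| * 2 ^ #|AP| * maxn 1 #|AP| * delta_B A
                 * maxn 1 (delta_E A) * maxn 1 (delta_E A + delta_U A))].
Proof.
exists 1000 => AP A nonalt; exists (automaton_formula A); split.
- exact: is_EQCTL2_automaton_formula.
- move=> D T leaf_T.
  apply: iff_trans (in_languageP T nonalt) _.
  exact: iff_sym (models_automaton_formula A leaf_T).
exact: size_automaton_formula.
Qed.
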